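(* Let $O_{A_{\mathbb{N}}}$ be the universal $C^*$-algebra generated by partial isometries $\{s_i:i=0,1,2,\ldots\}$ satisfying $s_i^*s_j=0$ for $i\neq j$ and $s_i^*s_i=\sum_{k=0}^i s_ks_k^*$ for all $i\geq 0$, and let $J$ be the (closed two-sided) ideal generated by $s_0-s_0s_0^*$. If $\pi$ is an irreducible representation of $O_{A_{\mathbb{N}}}/J\cong\mathcal{W}_{\mathbb{N}}$, then either $\pi$ is (unitarily equivalent to) the Fock representation or there exist $n\geq 1$ and $z\in\mathbb{T}$ such that $\pi\cong\widetilde{\pi}_{n,z}$.
   Context: $\mathbb{T}$ is the unit circle in $\mathbb{C}$, $\mathbb{N}=\{1,2,\ldots\}$. The weakly monotone Fock space $\mathcal{F}_{wm}(\ell^2(\mathbb{N}))$ is the Hilbert space with orthonormal basis the vacuum $\Omega$ and all $e_{i_1}\otimes\cdots\otimes e_{i_k}$, $k\geq 1$, $i_1\geq\cdots\geq i_k\geq 1$ (a closed subspace of the full Fock space over $\ell^2(\mathbb{N})$). For $i\in\mathbb{N}$, $A_i^\dagger\Omega=e_i$ and $A_i^\dagger\, e_{i_1}\otimes\cdots\otimes e_{i_k}=e_i\otimes e_{i_1}\otimes\cdots\otimes e_{i_k}$ if $i\geq i_1$ and $0$ otherwise; $A_i$ is the adjoint. $P_\Omega$ is the projection onto $\mathbb{C}\Omega$. $\mathcal{W}_{\mathbb{N}}$ is the $C^*$-algebra generated by $\{A_i,A_i^\dagger:i\in\mathbb{N}\}$ on $\mathcal{F}_{wm}(\ell^2(\mathbb{N}))$.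 For $z\in\mathbb{T}$, $\widetilde{\pi}_{0,z}$ is the representation of $O_{A_{\mathbb{N}}}$ on $\mathcal{F}_{wm}(\ell^2(\mathbb{N}))$ with $\widetilde{\pi}_{0,z}(s_0)=zP_\Omega$ and $\widetilde{\pi}_{0,z}(s_i)=A_i^\dagger$, $i\geq 1$. The Fock representation is $\pi_F=\widetilde{\pi}_{0,1}$; it vanishes on $J$ and induces the identification $O_{A_{\mathbb{N}}}/J\cong\mathcal{W}_{\mathbb{N}}$. For $n\geq 1$ let $J_n$ be the closed two-sided ideal generated by $\{s_0,\ldots,s_{n-1}\}$, $p_n:O_{A_{\mathbb{N}}}\to O_{A_{\mathbb{N}}}/J_n$ the quotient map, and $\Psi_n:O_{A_{\mathbb{N}}}\to O_{A_{\mathbb{N}}}/J_n$ the $*$-isomorphism determined by $\Psi_n(s_i)=[s_{i+n}]_{J_n}$; put $\widetilde{\pi}_{n,z}:=\widetilde{\pi}_{0,z}\circ\Psi_n^{-1}\circ p_n$ (explicitly, $\widetilde{\pi}_{n,z}(s_i)=0$ for $i<n$, $\widetilde{\pi}_{n,z}(s_n)=zP_\Omega$, $\widetilde{\pi}_{n,z}(s_{n+i})=A_i^\dagger$ for $i\geq 1$). For $n\geq 1$ one has $\widetilde{\pi}_{n,z}(s_0)=0$, so $\widetilde{\pi}_{n,z}$ vanishes on $J$ and is regarded as a representation of $O_{A_{\mathbb{N}}}/J$. *)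

(* Defs.v *)
From HB Require Import structures.
From mathcomp Require Import all_boot all_order all_algebra.
From mathcomp Require Import sesquilinear complex.
From mathcomp Require Import boolp classical_sets reals topology normedtype.

Set Implicit Arguments.
Unset Strict Implicit.
Unset Printing Implicit Defensive.
Import Order.TTheory GRing.Theory Num.Theory.
Import numFieldNormedType.Exports.

Local Open Scope classical_set_scope.
Local Open Scope complex_scope.
Local Open Scope ring_scope.

(** Complex C*-algebras, not assumed unital: MathComp rings have a unit, so the
    product is a separate operation on a complex Banach space. *)

HB.mixin Record BanachSpace_isCStarAlgebra (R : realType) A
    of CompleteNormedModule R[i] A := {
  amul : A -> A -> A;
  star : A -> A;
  amulA : associative amul;
  amulDl : left_distributive amul +%R;
  amulDr : right_distributive amul +%R;
  amulZl : forall (c : R[i]) (a b : A), amul (c *: a) b = c *: amul a b;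
  amulZr : forall (c : R[i]) (a b : A), amul a (c *: b) = c *: amul a b;
  starK : involutive star;
  starD : {morph star : a b / a + b};
  starZ : forall (c : R[i]) (a : A), star (c *: a) = c^* *: star a;
  starM : forall a b : A, star (amul a b) = amul (star b) (star a);
  norm_amul : forall a b : A, `|amul a b| <= `|a| * `|b|;
  norm_cstar : forall a : A, `|amul (star a) a| = `|a| ^+ 2;
}.

#[short(type="cstarAlgType")]
HB.structure Definition CStarAlgebra (R : realType) :=
  {A of BanachSpace_isCStarAlgebra R A & CompleteNormedModule R[i] A}.

Declare Scope cstar_scope.
Delimit Scope cstar_scope with cstar.
Notation "a ** b" := (amul a b) (at level 40, left associativity) : cstar_scope.
Notation "a ^†" := (star a) (at level 2, format "a ^†") : cstar_scope.
Local Open Scope cstar_scope.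

(** Complex Hilbert spaces; the inner product is linear on the left. *)

HB.mixin Record BanachSpace_isHilbert (R : realType) H
    of CompleteNormedModule R[i] H := {
  inner : {dot H for @Num.conj R[i]};
  inner_norm : forall x : H, inner x x = `|x| ^+ 2;
}.

#[short(type="hilbertType")]
HB.structure Definition Hilbert (R : realType) :=
  {H of BanachSpace_isHilbert R H & CompleteNormedModule R[i] H}.

Section Subspaces.
Context {R : realType}.

Definition closed_linear_subspace (V : normedModType R[i]) (W : set V) : Prop :=
  [/\ closed W, W 0 & forall (c : R[i]) x y, W x -> W y -> W (c *: x + y)].

Definition closed_star_subalgebra (A : cstarAlgType R) (B : set A) : Prop :=
  [/\ closed_linear_subspace B,
      forall a b, B a -> B b -> B (a ** b) &
      forall a, B a -> B a^†].

Definition closed_ideal (A : cstarAlgType R) (I : set A) : Prop :=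
  closed_linear_subspace I /\
  forall a x, I x -> I (a ** x) /\ I (x ** a).

Definition closed_ideal_generated (A : cstarAlgType R) (X : set A) : set A :=
  [set x | forall I : set A, closed_ideal I -> X `<=` I -> I x].

End Subspaces.

Section Morphisms.
Context {R : realType}.

Definition star_hom (A B : cstarAlgType R) (f : A -> B) : Prop :=
  [/\ linear f,
      forall a b, f (a ** b) = f a ** f b &
      forall a, f a^† = (f a)^†].

(** [q : A -> Q] exhibits [Q] as the quotient C*-algebra [A / I]; the last two
    clauses say that [`|q a|] is the infimum of [`|a + x|] over [x] in [I]. *)
Definition is_quotient (A Q : cstarAlgType R) (I : set A) (q : A -> Q) : Prop :=
  [/\ star_hom q,
      forall b, exists a, q a = b,
      forall a, q a = 0 <-> I a,
      forall a x, I x -> `|q a| <= `|a + x| &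
      forall a (eps : R[i]), 0 < eps ->
        exists2 x, I x & `|a + x| < `|q a| + eps].

(** The defining relations of [O_{A_N}]. *)
Definition OAN_relations (A : cstarAlgType R) (s : nat -> A) : Prop :=
  [/\ forall i, s i ** (s i)^† ** s i = s i,
      forall i j, i != j -> (s i)^† ** s j = 0 &
      forall i, (s i)^† ** s i = \sum_(k < i.+1) s k ** (s k)^†].

(** [O] is the universal C*-algebra generated by a sequence [s] subject to
    these relations. *)
Definition is_OAN (O : cstarAlgType R) (s : nat -> O) : Prop :=
  [/\ OAN_relations s,
      forall B : set O,
        closed_star_subalgebra B -> (forall i, B (s i)) -> B = setT &
      forall (B : cstarAlgType R) (t : nat -> B), OAN_relations t ->
        exists2 f : O -> B, star_hom f & forall i, f (s i) = t i].

End Morphisms.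

Section Representations.
Context {R : realType}.

Definition bounded_operator (H : hilbertType R) (T : H -> H) : Prop :=
  linear T /\ continuous T.

Definition representation (A : cstarAlgType R) (H : hilbertType R)
    (pi : A -> H -> H) : Prop :=
  [/\ forall a, bounded_operator (pi a),
      forall (c : R[i]) a b x, pi (c *: a + b) x = c *: pi a x + pi b x,
      forall a b x, pi (a ** b) x = pi a (pi b x) &
      forall a x y, inner (pi a x) y = inner x (pi a^† y)].

Definition irreducible (A : cstarAlgType R) (H : hilbertType R)
    (pi : A -> H -> H) : Prop :=
  [/\ representation pi,
      exists a x, pi a x <> 0 &
      forall W : set H, closed_linear_subspace W ->
        (forall a x, W x -> W (pi a x)) -> W = [set 0] \/ W = setT].

Definition unitarily_equivalent (A : cstarAlgType R) (H K : hilbertType R)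
    (pi : A -> H -> H) (rho : A -> K -> K) : Prop :=
  exists U : H -> K,
    [/\ linear U,
        forall y, exists x, U x = y,
        forall x y, inner (U x) (U y) = inner x y &
        forall a x, U (pi a x) = rho a (U x)].

End Representations.

Section Fock.
Context {R : realType}.

(** The words [i_1 >= ... >= i_k >= 1]; the empty word labels the vacuum. *)
Definition wm_word (w : seq nat) : bool :=
  sorted geq w && all (fun i => 1 <= i)%N w.

(** [e w], for [w] a word as above, is an orthonormal basis of [F], i.e. [F]
    is the weakly monotone Fock space with [e [:: i_1; ...; i_k]] standing for
    the tensor of the [e_{i_j}]. The values of [e] at other sequences are
    irrelevant. *)
Definition is_wm_Fock_space (F : hilbertType R) (e : seq nat -> F) : Prop :=
  (forall v w, wm_word v -> wm_word w -> inner (e v) (e w) = (v == w)%:R) /\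
  (forall W : set F, closed_linear_subspace W ->
     (forall w, wm_word w -> W (e w)) -> W = setT).

(** [T] is the creation operator at [i]; since [head 0 [::] = 0], the vacuum is
    covered by the first branch. *)
Definition is_creation (F : hilbertType R) (e : seq nat -> F) (i : nat)
    (T : F -> F) : Prop :=
  bounded_operator T /\
  forall w, wm_word w ->
    T (e w) = if (head 0 w <= i)%N then e (i :: w) else 0.

Definition vacuum_projection (F : hilbertType R) (e : seq nat -> F) (x : F) : F :=
  inner x (e [::]) *: e [::].

(** [rho] is the representation [pi~_{n,z}] of [O_{A_N}], which is determined
    by its values on the generators [s]; [Ad i] is the creation operator at
    [i >= 1]. *)
Definition is_pi_tilde (O : cstarAlgType R) (s : nat -> O) (F : hilbertType R)
    (e : seq nat -> F) (Ad : nat -> F -> F) (n : nat) (z : R[i])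
    (rho : O -> F -> F) : Prop :=
  [/\ representation rho,
      forall i x, (i < n)%N -> rho (s i) x = 0,
      forall x, rho (s n) x = z *: vacuum_projection e x &
      forall i x, (1 <= i)%N -> rho (s (n + i)%N) x = Ad i x].

Definition is_Fock_representation (O : cstarAlgType R) (s : nat -> O)
    (F : hilbertType R) (e : seq nat -> F) (Ad : nat -> F -> F)
    (rho : O -> F -> F) : Prop :=
  is_pi_tilde s e Ad 0 1 rho.

End Fock.

(* Main.v *)
Require Import Defs.
From mathcomp Require Import all_boot all_order all_algebra.
From mathcomp Require Import sesquilinear complex.
From mathcomp Require Import boolp classical_sets reals topology normedtype.
From mathcomp Require Import sequences.
From mathcomp Require Import ring lra.

(** Let [pi] be irreducible and let [S i] be the image of the generator [s i].
    Some [S i] is nonzero; let [n] be the least such index. The relations then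
    say that [S n] is normal, with [P = S n (S n)^†] as its range and source
    projection, and that each [S m] maps the range of [S k] isometrically when
    [k <= m] and to 0 otherwise. Hence a unit vector [x0] of the range of [P]
    behaves as a vacuum: the vectors obtained by applying [S (n + i)] along the
    weakly monotone words form an orthonormal family, and [pi] acts on them by
    the formulas that define the representation on Fock space, provided [x0]
    is an eigenvector of [S n]. Their closed span is then stable, so it is the
    whole space, and matching the bases gives the unitary equivalence. The
    eigenvalue [z] has modulus 1; when [n = 0] the operator [S 0] is a
    projection because [s 0 - s 0 (s 0)^†] vanishes in the quotient, so [z = 1]
    and the representation is the Fock representation.

    It remains to find the eigenvector. A closed subspace [M] of the range of
    [P] that is stable under [S n] and its adjoint generates, through the same
    words, a stable subspace that meets the range of [P] in [M]
    ([vacuum_subspace]). So the normal operator [S n] acts irreducibly on that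
    range, and a Schur lemma ([symmetric_scalar]), applied to its real and
    imaginary parts, makes it a scalar there ([vacuum_scalar]). The spectral
    theorem is avoided: the Schur lemma only needs an absolute value of
    a symmetric operator that commutes with everything which commutes with it.

    A subspace stable under the [S i] and their adjoints is stable under the
    whole algebra only because representations are norm-continuous, which has
    to be proved since each [pi a] is merely assumed to be bounded. Both this
    ([repr_bound]) and the absolute value ([operator_abs]) come from one
    construction: the solution [Z] of [Z = A + Z ^+ 2] for an operator [A] of
    norm at most 1/4, so that [1/2 - Z] is a square root of [1/4 - A]. For the
    absolute value of [T] one takes [A = 1/4 - T ^+ 2]; for contractivity one
    takes left multiplication by [c^† c] on the algebra itself, which has no
    unit in general. *)

Set Implicit Arguments.
Unset Strict Implicit.
Unset Printing Implicit Defensive.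
Import Order.TTheory GRing.Theory Num.Theory.
Import numFieldNormedType.Exports.

Local Open Scope classical_set_scope.
Local Open Scope complex_scope.
Local Open Scope ring_scope.
Local Open Scope cstar_scope.

(** * Closed subspaces of normed spaces *)

Section NormedSpaces.
Context {R : realType}.
Implicit Types V W : normedModType R[i].

Lemma lipschitz_continuous V W (f : V -> W) (C : R[i]) :
  (forall x y, `|f x - f y| <= C * `|x - y|) -> continuous f.
Proof.
move=> fC x; apply/cvgrPdist_lt => e e0.
have C0 : 0 < `|C| + 1 by rewrite ltr_wpDl.
near=> y.
have xy : `|x - y| < e / (`|C| + 1).
  near: y; apply: cvgr_dist_lt; rewrite ?divr_gt0 //; exact: cvg_id.
apply: le_lt_trans (fC x y) _.
have Cxy : 0 <= C * `|x - y| := le_trans (normr_ge0 _) (fC x y).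
rewrite -(ger0_norm Cxy) normrM normr_id.
apply: (@le_lt_trans _ _ ((`|C| + 1) * `|x - y|)).
  by apply: ler_wpM2r => //; rewrite lerDl.
by rewrite mulrC -ltr_pdivlMr.
Unshelve. all: by end_near.
Qed.

Lemma closed_equalizer V W (f g : V -> W) :
  continuous f -> continuous g -> closed [set x | f x = g x].
Proof.
move=> cf cg.
have -> : [set x | f x = g x] = (f \- g) @^-1` [set 0].
  by apply/seteqP; split=> x /= => [->|/subr0_eq//]; rewrite subrr.
apply: preimage_closed.
  by move=> x _; apply: cvgB; [exact: cf|exact: cg].
by apply: accessible_closed_set1; apply: hausdorff_accessible; exact: norm_hausdorff.
Qed.

Lemma closed_approxP V (W : set V) : closed W <->
  forall x, (forall e : R[i], 0 < e -> exists2 y, W y & `|x - y| < e) -> W x.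
Proof.
split=> [cW x h|h x cx].
  apply: cW => B /nbhs_ballP[e /= e0 xB].
  have [y Wy xy] := h _ e0; exists y; split=> //; apply: xB.
  by rewrite -ball_normE.
apply: h => e e0; have [y [Wy]] := cx _ (nbhsx_ballx x e e0).
by rewrite -ball_normE; exists y.
Qed.

End NormedSpaces.

(** * Inner products *)

Section InnerProduct.
Context {R : realType} {H : hilbertType R}.
Implicit Types x y z : H.

Lemma innerDl x y z : inner (x + y) z = inner x z + inner y z.
Proof. by rewrite linearDl. Qed.
Lemma innerBl x y z : inner (x - y) z = inner x z - inner y z.
Proof. by rewrite linearBl. Qed.
Lemma innerZl (c : R[i]) x z : inner (c *: x) z = c * inner x z.
Proof. by rewrite linearZl_LR. Qed.
Lemma innerC x y : inner y x = (inner x y)^*.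
Proof. by rewrite (hermC _ y x)/= expr0 mul1r. Qed.
Lemma innerDr x y z : inner x (y + z) = inner x y + inner x z.
Proof. by rewrite linearDr. Qed.
Lemma innerBr x y z : inner x (y - z) = inner x y - inner x z.
Proof. by rewrite linearBr. Qed.
Lemma innerZr (c : R[i]) x z : inner x (c *: z) = c^* * inner x z.
Proof. by rewrite linearZr_LR. Qed.
Lemma inner0l x : inner 0 x = 0. Proof. by rewrite linear0l. Qed.
Lemma inner0r x : inner x 0 = 0. Proof. by rewrite linear0r. Qed.

Lemma inner_self_ge0 x : 0 <= inner x x.
Proof. by rewrite inner_norm exprn_ge0. Qed.

Lemma inner_self_eq0 x : inner x x = 0 -> x = 0.
Proof. by rewrite inner_norm => /eqP; rewrite sqrf_eq0 normr_eq0 => /eqP. Qed.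

Lemma Cauchy_Schwarz x y : `|inner x y| <= `|x| * `|y|.
Proof.
have [->|y0] := eqVneq y 0; first by rewrite inner0r !normr0 mulr0.
have ny0 : 0 < `|y| ^+ 2 by rewrite exprn_gt0 // normr_gt0.
rewrite -(@ler_pXn2r _ 2) ?nnegrE ?mulr_ge0 // exprMn.
(* the squared norm of the component of [x] orthogonal to [y] *)
have := inner_self_ge0 (`|y| ^+ 2 *: x - inner x y *: y).
rewrite innerBl !innerBr !innerZl !innerZr !inner_norm (innerC x y) normCK.
have -> : Num.conj (`|y| ^+ 2) = `|y| ^+ 2 :> R[i].
  by apply/conj_Creal/ger0_real; rewrite exprn_ge0.
set a := `|y| ^+ 2; set b := `|x| ^+ 2; set c := inner x y; set d := Num.conj c.
have -> : a * (a * b) - a * (d * c) - (c * (a * d) - c * (d * a)) =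
          a * (b * a - c * d) by ring.
by rewrite pmulr_rge0 // subr_ge0.
Qed.

Lemma inner_continuousl y : continuous (fun x => inner x y : R[i]^o).
Proof.
apply: (@lipschitz_continuous _ _ _ _ `|y|) => u v.
by rewrite -innerBl mulrC Cauchy_Schwarz.
Qed.

End InnerProduct.

(** * Closed linear spans *)

Section Subspaces.
Context {R : realType}.
Implicit Types V W : normedModType R[i].

Lemma linear0E V W (f : V -> W) : linear f -> f 0 = 0.
Proof.
move=> lf; have := lf 1 0 0; rewrite !scale1r addr0 => /eqP.
by rewrite eq_sym -subr_eq0 addrK => /eqP.
Qed.

Lemma linearDE V W (f : V -> W) : linear f -> {morph f : x y / x + y}.
Proof. by move=> lf x y; have := lf 1 x y; rewrite !scale1r. Qed.

Lemma linearZE V W (f : V -> W) :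
  linear f -> forall (c : R[i]) x, f (c *: x) = c *: f x.
Proof.
move=> lf c x; have := lf c x 0.
by rewrite (linear0E lf) !addr0.
Qed.

Lemma linearBE V W (f : V -> W) : linear f -> {morph f : x y / x - y}.
Proof.
move=> lf x y; rewrite -[- y]scaleN1r (linearDE lf) (linearZE lf).
by rewrite scaleN1r.
Qed.

Lemma subspaceZ V (M : set V) : closed_linear_subspace M ->
  forall (c : R[i]) x, M x -> M (c *: x).
Proof. by case=> _ M0 Ml c x Mx; rewrite -[_ *: _]addr0; apply: Ml. Qed.

Lemma subspaceD V (M : set V) : closed_linear_subspace M ->
  forall x y, M x -> M y -> M (x + y).
Proof. by case=> _ _ Ml x y Mx My; rewrite -[x]scale1r; apply: Ml. Qed.

Lemma subspaceB V (M : set V) : closed_linear_subspace M ->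
  forall x y, M x -> M y -> M (x - y).
Proof.
move=> sM x y Mx My; apply: (subspaceD sM) => //.
by rewrite -scaleN1r; apply: subspaceZ.
Qed.

Lemma equalizer_subspace V W (f g : V -> W) :
  linear f -> continuous f -> linear g -> continuous g ->
  closed_linear_subspace [set x | f x = g x].
Proof.
move=> lf cf lg cg; split; first exact: closed_equalizer.
  by rewrite /= !linear0E.
by move=> c x y /= fx fy; rewrite lf lg fx fy.
Qed.

Lemma preimage_subspace V W (f : V -> W) (M : set W) :
  linear f -> continuous f -> closed_linear_subspace M ->
  closed_linear_subspace (f @^-1` M).
Proof.
move=> lf cf [cM M0 Ml]; split;
  first by apply: preimage_closed => // x _; exact: cf.
  by rewrite /preimage/= linear0E.
by move=> c x y /= Mx My; rewrite lf; apply: Ml.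
Qed.

Lemma bigcap_subspace V (I : Type) (D : set I) (M : I -> set V) :
  (forall i, D i -> closed_linear_subspace (M i)) ->
  closed_linear_subspace (\bigcap_(i in D) M i).
Proof.
move=> sM; split.
- by apply: closed_bigI => i /sM[].
- by move=> i /sM[].
- move=> c x y Mx My i Di; have [_ _ Ml] := sM i Di.
  by apply: Ml; [exact: Mx|exact: My].
Qed.

Lemma setI_subspace V (M N : set V) :
  closed_linear_subspace M -> closed_linear_subspace N ->
  closed_linear_subspace (M `&` N).
Proof.
move=> [cM M0 Ml] [cN N0 Nl]; split; first exact: closedI.
- by split.
- by move=> c x y [Mx Nx] [My Ny]; split; [apply: Ml|apply: Nl].
Qed.

Definition closed_span V (X : set V) : set V :=
  [set x | forall M, closed_linear_subspace M -> X `<=` M -> M x].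

Lemma sub_closed_span V (X : set V) : X `<=` closed_span X.
Proof. by move=> x Xx M _; apply. Qed.

Lemma closed_span_sub V (X M : set V) :
  closed_linear_subspace M -> X `<=` M -> closed_span X `<=` M.
Proof. by move=> sM XM x; apply. Qed.

Lemma closed_span_subspace V (X : set V) :
  closed_linear_subspace (closed_span X).
Proof.
have -> : closed_span X =
    \bigcap_(M in [set M | closed_linear_subspace M /\ X `<=` M]) M.
  by apply/seteqP; split=> [x xX M [sM XM]|x xX M sM XM]; apply: xX.
by apply: bigcap_subspace => M [].
Qed.

Lemma set0_subspace V : closed_linear_subspace [set 0 : V].
Proof.
split=> [||c x y /= -> ->]; last 2 first; rewrite /= ?scaler0 ?addr0 //.
by apply: accessible_closed_set1; apply: hausdorff_accessible; exact: norm_hausdorff.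
Qed.

Lemma closed_span_stable V (X : set V) (f : V -> V) :
  linear f -> continuous f -> (forall x, X x -> closed_span X (f x)) ->
  forall x, closed_span X x -> closed_span X (f x).
Proof.
move=> lf cf Xf; apply: (@closed_span_sub _ X (f @^-1` closed_span X)) => //.
by apply: preimage_subspace => //; exact: closed_span_subspace.
Qed.

End Subspaces.

Section Line.
Context {R : realType} {H : hilbertType R}.

Lemma line_subspace (x : H) :
  `|x| = 1 -> closed_linear_subspace [set y | y = inner y x *: x].
Proof.
move=> x1; apply: equalizer_subspace => //.
- by move=> y; exact: cvg_id.
- by move=> c u v; rewrite innerDl innerZl scalerDl scalerA.
- apply: (@lipschitz_continuous _ _ _ _ 1) => u v.
  rewrite -scalerBl -innerBl normrZ x1 mulr1 mul1r.
  by have := Cauchy_Schwarz (u - v) x; rewrite x1 mulr1.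
Qed.
End Line.

(** * Solving Z = A + Z^2 *)

Section Limits.
Context {R : realType}.

(** The scalars are complex numbers, whose order is only partial, so the
    archimedean property has to be read off the real part. *)
Lemma small_fraction (C e : R[i]) : 0 <= C -> 0 < e ->
  exists N, forall n, (N <= n)%N -> C / n.+1%:R < e.
Proof.
move=> C0 e0; have Ce : 0 <= C / e by rewrite divr_ge0 // ltW.
have := archi_boundP (_ : 0 <= complex.Re (C / e)).
rewrite -lecR -ltcR RRe_real ?ger0_real // => /(_ Ce) bnd.
exists (Num.bound (complex.Re (C / e))) => n Nn.
rewrite ltr_pdivrMr ?ltr0n // mulrC -ltr_pdivrMr //.
apply: lt_le_trans bnd _.
rewrite rmorph_nat ler_nat; exact: leqW.
Qed.

Lemma cvg_rate (V : normedModType R[i]) (u : nat -> V) (l : V) (C : R[i]) :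
  0 <= C -> (forall k, `|l - u k| <= C / k.+1%:R) -> u @ \oo --> l.
Proof.
move=> C0 ul; apply/cvgrPdist_lt => e e0.
have [N hN] := small_fraction C0 e0.
by exists N => // n /= Nn; apply: le_lt_trans (ul n) (hN _ Nn).
Qed.

Lemma cauchy_rate (V : completeNormedModType R[i]) (u : nat -> V) (C : R[i]) :
  0 <= C ->
  (forall k m, (k <= m)%N -> `|u k - u m| <= C / k.+1%:R) ->
  cvg (u @ \oo).
Proof.
move=> C0 uu; apply: cauchy_cvg; apply: cauchy_exP => e e0.
have [N hN] := small_fraction C0 e0.
exists (u N); exists N => // n /= Nn; rewrite -ball_normE.
exact: le_lt_trans (uu N n Nn) (hN _ (leqnn N)).
Qed.

Lemma seq_lim_unique (V : normedModType R[i]) (u : nat -> V) (l l' : V) :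
  u @ \oo --> l -> u @ \oo --> l' -> l = l'.
Proof. by move=> ul ul'; apply: (norm_cvg_unique ul ul'). Qed.

Lemma cvg_norm_le (V : normedModType R[i]) (u : nat -> V) (l : V) (C : R[i]) :
  u @ \oo --> l -> (forall k, `|u k| <= C) -> `|l| <= C.
Proof.
move=> /cvgrPdist_lt ul uC; apply/ler_addgt0Pr => e e0.
have [N _ hN] := ul e e0.
rewrite -(subrK (u N) l) addrC.
apply: le_trans (ler_normD _ _) _; apply: lerD; first exact: uC.
by apply/ltW/hN => /=.
Qed.

End Limits.

Section QuadraticEquation.
Context {R : realType} {V : completeNormedModType R[i]}.
Variable A : V -> V.
Hypothesis linA : linear A.
Hypothesis boundA : forall v, `|A v| <= 4^-1 * `|v|.

Fixpoint quad_iter (k : nat) (v : V) : V :=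
  if k is k'.+1 then A v + quad_iter k' (quad_iter k' v) else 0.

Fixpoint quad_bound (k : nat) : R :=
  if k is k'.+1 then 4^-1 + quad_bound k' ^+ 2 else 0.

Definition quad_lim (v : V) : V := lim (quad_iter ^~ v @ \oo).

Lemma quad_iter_linear k : linear (quad_iter k).
Proof.
elim: k => [|k IH] c x y /=; first by rewrite scaler0 addr0.
by rewrite linA !IH scalerDr addrACA.
Qed.

Lemma quad_bound_ge0 k : 0 <= quad_bound k.
Proof. by case: k => //= k; rewrite addr_ge0 ?invr_ge0 // sqr_ge0. Qed.

Lemma quad_bound_incr k : quad_bound k <= quad_bound k.+1.
Proof. by rewrite /=; have := sqr_ge0 (2^-1 - quad_bound k); nra. Qed.

Lemma quad_bound_half k : quad_bound k <= 2^-1.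
Proof.
elim: k => [|k IH] /=; first by rewrite invr_ge0.
have := quad_bound_ge0 k; nra.
Qed.

(** The defect [d = 1/2 - quad_bound k] satisfies [d' = d - d ^+ 2], which is
    the recursion of a sequence bounded by [1 / (k + 2)]. *)
Lemma quad_bound_rate k : 2^-1 - quad_bound k <= k.+2%:R^-1.
Proof.
elim: k => [|k IH] /=; first by rewrite subr0.
have := quad_bound_half k; have := quad_bound_ge0 k.
move: (quad_bound k) IH => z IH z0 z1.
have a0 : 0 < k.+2%:R^-1 :> R by rewrite invr_gt0 ltr0n.
have a1 : k.+2%:R^-1 <= 2^-1 :> R by rewrite lef_pV2 ?posrE ?ltr0n // ler_nat.
have b0 : 0 < k.+3%:R^-1 :> R by rewrite invr_gt0 ltr0n.
have ba : k.+3%:R^-1 * (1 + k.+2%:R^-1) = k.+2%:R^-1 :> R.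
  have na : k.+2%:R * k.+2%:R^-1 = 1 :> R by rewrite divff // pnatr_eq0.
  have nb : k.+3%:R * k.+3%:R^-1 = 1 :> R by rewrite divff // pnatr_eq0.
  move: nb; rewrite -{1}natr1; move: na; move: k.+2%:R => n; move: (n^-1) => a na nb.
  apply/subr0_eq; have -> : k.+3%:R^-1 * (1 + a) - a =
    a * ((n + 1) * k.+3%:R^-1 - 1) - k.+3%:R^-1 * (n * a - 1) by ring.
  by rewrite na nb !subrr !mulr0 subrr.
move: (k.+2%:R^-1) (k.+3%:R^-1) IH a0 a1 b0 ba => a b IH a0 a1 b0 ba.
have : 0 <= (a - (2^-1 - z)) * (1 - a - (2^-1 - z)).
  by apply: mulr_ge0; lra.
have ba_le : b <= a by rewrite -ba mulrDr mulr1 lerDl mulr_ge0 // ltW.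
have : 0 <= a * (a - b) by rewrite mulr_ge0 ?subr_ge0 // ltW.
lra.
Qed.

Lemma quad_iter_bound k v : `|quad_iter k v| <= (quad_bound k)%:C * `|v|.
Proof.
elim: k v => [|k IH] v /=; first by rewrite normr0 mul0r.
apply: le_trans (ler_normD _ _) _.
rewrite rmorphD/= mulrDl; apply: lerD.
  by apply: le_trans (boundA v) _; rewrite fmorphV rmorph_nat.
apply: le_trans (IH _) _; rewrite expr2 rmorphM/= -mulrA.
by apply: ler_wpM2l => //; rewrite lecR quad_bound_ge0.
Qed.

(** The increments of the iteration are dominated by those of the numerical
    one, because [x ^+ 2 - y ^+ 2 = x (x - y) + (x - y) y] for operators. *)
Lemma quad_iter_step k v : `|quad_iter k.+1 v - quad_iter k v| <=
  (quad_bound k.+1 - quad_bound k)%:C * `|v|.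
Proof.
elim: k v => [|k IH] v.
  by have := quad_iter_bound 1 v; rewrite /= !subr0.
set z' := quad_bound k.+1; set Z' := quad_iter k.+1.
pose z := quad_bound k; pose Z := quad_iter k.
have -> : quad_iter k.+2 v - Z' v = Z' (Z' v - Z v) + (Z' (Z v) - Z (Z v)).
  rewrite {2}/Z' (linearBE (quad_iter_linear k.+1)) addrA subrK.
  rewrite -[LHS]/(A v + Z' (Z' v) - (A v + Z (Z v))).
  by rewrite opprD addrACA subrr add0r.
have -> : quad_bound k.+2 - z' = z' * (z' - z) + (z' - z) * z.
  by rewrite -[LHS]/(4^-1 + z' ^+ 2 - (4^-1 + z ^+ 2)); ring.
rewrite rmorphD/= !rmorphM/= mulrDl; apply: le_trans (ler_normD _ _) _.
have z'_ge0 := quad_bound_ge0 k.+1.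
have dz_ge0 : 0 <= z' - z by rewrite subr_ge0 quad_bound_incr.
apply: lerD.
  apply: le_trans (quad_iter_bound _ _) _; rewrite -mulrA.
  by apply: ler_wpM2l; rewrite ?lecR.
apply: le_trans (IH _) _; rewrite -mulrA.
by apply: ler_wpM2l; rewrite ?lecR //; apply: quad_iter_bound.
Qed.

(** Telescoping the increments, the numerical sequence controls the operators
    and gives an explicit Cauchy modulus. *)
Lemma quad_iter_rate k m v : (k <= m)%N ->
  `|quad_iter k v - quad_iter m v| <= `|v| / k.+1%:R.
Proof.
move=> km; have H : `|quad_iter k v - quad_iter m v| <=
    (quad_bound m - quad_bound k)%:C * `|v|.
  rewrite -(subnKC km); elim: (m - k)%N => [|d IH].
    by rewrite addn0 !subrr normr0 mul0r.
  rewrite addnS -(subrKA (quad_iter (k + d) v)).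
  apply: le_trans (ler_normD _ _) _.
  have -> : quad_bound (k + d).+1 - quad_bound k =
    (quad_bound (k + d) - quad_bound k) +
    (quad_bound (k + d).+1 - quad_bound (k + d)) by ring.
  rewrite rmorphD mulrDl; apply: lerD => //.
  by rewrite distrC; apply: quad_iter_step.
apply: le_trans H _; rewrite mulrC; apply: ler_wpM2l => //.
rewrite -(rmorph_nat (real_complex R)) -fmorphV lecR.
apply: (@le_trans _ _ k.+2%:R^-1); last first.
  by rewrite lef_pV2 ?posrE ?ltr0n // ler_nat.
have := quad_bound_rate k; have := quad_bound_half m.
by move: k.+2%:R^-1 (quad_bound k) (quad_bound m) => a zk zm; lra.
Qed.

Lemma quad_lim_cvg v : quad_iter ^~ v @ \oo --> quad_lim v.
Proof. by apply: (@cauchy_rate _ _ _ `|v|) => // k m; apply: quad_iter_rate. Qed.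

Lemma quad_lim_linear : linear quad_lim.
Proof.
move=> c x y; apply: (seq_lim_unique (@quad_lim_cvg _)).
have -> : quad_iter ^~ (c *: x + y) =
    (fun k => c *: quad_iter k x + quad_iter k y).
  by apply/funext => k; rewrite quad_iter_linear.
by apply: cvgD; [apply: cvgZr|]; exact: quad_lim_cvg.
Qed.

Lemma quad_lim_bound v : `|quad_lim v| <= 2^-1 * `|v|.
Proof.
apply: (cvg_norm_le (@quad_lim_cvg v)) => k.
apply: le_trans (quad_iter_bound _ _) _; apply: ler_wpM2r => //.
by rewrite -(rmorph_nat (real_complex R)) -fmorphV lecR quad_bound_half.
Qed.

Lemma quad_lim_eq v : quad_lim v = A v + quad_lim (quad_lim v).
Proof.
apply: (seq_lim_unique (@quad_lim_cvg _)).
rewrite -(cvg_shiftS (quad_iter ^~ v)) /=.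
apply: cvgD; first exact: cvg_cst.
have -> : (fun k => quad_iter k (quad_iter k v)) = (fun k =>
    quad_iter k (quad_lim v) - quad_iter k (quad_lim v - quad_iter k v)).
  apply/funext => k; rewrite (linearBE (quad_iter_linear k)).
  by rewrite opprB addrC subrK.
rewrite -[X in _ --> X]subr0; apply: cvgB; first exact: quad_lim_cvg.
apply/cvgr0Pnorm_lt => e e0.
have /cvgrPdist_lt/(_ e e0)[N _ hN] := @quad_lim_cvg v.
exists N => // n /= Nn.
apply: le_lt_trans (hN n Nn); apply: le_trans (quad_iter_bound _ _) _.
rewrite -[leRHS]mul1r; apply: ler_wpM2r => //.
by rewrite -(rmorph1 (real_complex R)) lecR; have := quad_bound_half n; lra.
Qed.

(** The solution is a limit of polynomials in [A], so symmetry of [A] with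
    respect to a continuous pairing passes to it. The pairing is only biadditive
    because it is used with sesquilinear ones. *)
Lemma quad_lim_pairing (W : normedModType R[i]) (b : V -> V -> W) :
  (forall y, {morph b ^~ y : x x' / x + x'}) ->
  (forall x, {morph b x : y y' / y + y'}) ->
  (forall x, continuous (b x)) -> (forall y, continuous (b ^~ y)) ->
  (forall x y, b (A x) y = b x (A y)) ->
  forall x y, b (quad_lim x) y = b x (quad_lim y).
Proof.
move=> bDl bDr bcr bcl bA x y.
have b0l z : b 0 z = 0 by apply: (addrI (b 0 z)); rewrite -bDl !addr0.
have b0r z : b z 0 = 0 by apply: (addrI (b z 0)); rewrite -bDr !addr0.
apply: seq_lim_unique.
  by apply: (cvg_comp _ _ (@quad_lim_cvg x)); exact: bcl.
have -> : (fun z => b z y) \o quad_iter ^~ x = b x \o quad_iter ^~ y.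
  apply/funext => k /=; elim: k x y => [|k IH] x y /=; first by rewrite b0l b0r.
  by rewrite bDl bDr bA !IH.
by apply: (cvg_comp _ _ (@quad_lim_cvg y)); exact: bcr.
Qed.

Lemma quad_lim_comm (C : V -> V) : linear C -> continuous C ->
  (forall v, C (A v) = A (C v)) -> forall v, C (quad_lim v) = quad_lim (C v).
Proof.
move=> lC cC CA v; apply: seq_lim_unique.
  by apply: (cvg_comp _ _ (@quad_lim_cvg v)); exact: cC.
have -> : C \o quad_iter ^~ v = quad_iter ^~ (C v).
  apply/funext => k /=; elim: k v => [|k IH] v /=; first by rewrite linear0E.
  by rewrite (linearDE lC) CA !IH.
exact: quad_lim_cvg.
Qed.

(** Completing the square in [Z = A + Z ^+ 2] makes this a square root of
    [1/4 - A]. *)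
Definition quad_root (v : V) : V := 2^-1 *: v - quad_lim v.

Lemma quad_root_linear : linear quad_root.
Proof.
move=> c x y; rewrite /quad_root quad_lim_linear !scalerDr !scalerN !scalerA.
by rewrite [2^-1 * c]mulrC opprD addrACA.
Qed.

Lemma quad_root_sq v : quad_root (quad_root v) = 4^-1 *: v - A v.
Proof.
rewrite {1}/quad_root {2}/quad_root (linearBE quad_lim_linear).
rewrite (linearZE quad_lim_linear) scalerBr scalerA.
rewrite [quad_lim (quad_lim v)](_ : _ = quad_lim v - A v); last first.
  by rewrite [quad_lim v in RHS]quad_lim_eq addrC addKr.
have -> : 2^-1 * 2^-1 = 4^-1 :> R[i] by field.
set w := 2^-1 *: quad_lim v.
have -> : quad_lim v = w + w.
  by rewrite -scalerDl [2^-1 + 2^-1](_ : _ = 1) ?scale1r //; field.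
by rewrite opprB [w + w - _ - w]addrAC addrK addrA subrK.
Qed.

End QuadraticEquation.

(** * Automatic continuity of representations *)

Section CStarAlgebras.
Context {R : realType} {A : cstarAlgType R}.
Implicit Types a b c : A.

Lemma norm_star a : `|a^†| = `|a|.
Proof.
suff le b : `|b| <= `|b^†|.
  by apply: le_anti; rewrite le andbT -{2}[a]starK le.
have [->|b0] := eqVneq b 0; first by rewrite normr0.
rewrite -(@ler_pM2r _ `|b|) ?normr_gt0 // -expr2 -norm_cstar.
exact: norm_amul.
Qed.

Lemma amulBr a b c : a ** (b - c) = a ** b - a ** c.
Proof. by rewrite -[- c]scaleN1r amulDr amulZr scaleN1r. Qed.

Lemma amulBl a b c : (b - c) ** a = b ** a - c ** a.
Proof. by rewrite -[- c]scaleN1r amulDl amulZl scaleN1r. Qed.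

Lemma starB a b : (a - b)^† = a^† - b^†.
Proof. by rewrite -[- b]scaleN1r starD starZ rmorphN1 scaleN1r. Qed.

End CStarAlgebras.

Section Representations.
Context {R : realType} {A : cstarAlgType R} {H : hilbertType R}.
Variable pi : A -> H -> H.
Hypothesis repr_pi : representation pi.

Lemma repr_linear a : linear (pi a).
Proof. by have [/(_ a)[]] := repr_pi. Qed.

Lemma repr_continuous a : continuous (pi a).
Proof. by have [/(_ a)[]] := repr_pi. Qed.

Lemma repr_linearl x : linear (pi^~ x).
Proof. by have [_ h _ _] := repr_pi => c a b; apply: h. Qed.

Lemma reprM a b x : pi (a ** b) x = pi a (pi b x).
Proof. by have [_ _ h _] := repr_pi. Qed.

Lemma repr_adj a x y : inner (pi a x) y = inner x (pi a^† y).
Proof. by have [_ _ _ h] := repr_pi. Qed.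

Lemma repr_adjr a x y : inner x (pi a y) = inner (pi a^† x) y.
Proof. by rewrite repr_adj starK. Qed.

(** With [h = c^† c] and [Y] the square root of [1/4 - h] acting on the algebra
    by left multiplication, [v^† (1/4 v - h v) = (Y v)^† (Y v)] is positive in
    the representation. The algebra may lack a unit, so the bound is reached
    only on vectors of the form [pi v x]. *)
Lemma repr_half_bound c : `|c| <= 2^-1 -> forall v x,
  `|pi c (pi v x)| <= 2^-1 * `|pi v x|.
Proof.
move=> c2; pose h := c^† ** c; pose L v := h ** v.
have h_star : h^† = h by rewrite starM starK.
have linL : linear L by move=> k u v; rewrite /L amulDr amulZr.
have boundL v : `|L v| <= 4^-1 * `|v|.
  apply: le_trans (norm_amul _ _) _; apply: ler_wpM2r => //.
  rewrite norm_cstar (_ : 4^-1 = 2^-1 ^+ 2); last by field.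
  by rewrite ler_pXn2r ?nnegrE ?invr_ge0.
pose Y := quad_root L.
pose b (u v : A) := v^† ** u.
have bY u v : b (Y u) v = b u (Y v).
  have -> : b (Y u) v = 2^-1 *: b u v - b (quad_lim L u) v.
    by rewrite /b/Y/quad_root amulBr amulZr.
  have -> : b u (Y v) = 2^-1 *: b u v - b u (quad_lim L v).
    rewrite /b/Y/quad_root starB starZ amulBl amulZl; congr (_ *: _ - _).
    by rewrite conj_Creal // ger0_real // invr_ge0.
  congr (_ - _); apply: (quad_lim_pairing linL boundL) => //.
  - by move=> w z z'; rewrite /b amulDr.
  - by move=> w z z'; rewrite /b starD amulDl.
  - move=> w; apply: (@lipschitz_continuous _ _ _ _ `|w|) => z z'.
    rewrite /b -amulBl -starB; apply: le_trans (norm_amul _ _) _.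
    by rewrite norm_star mulrC.
  - move=> w; apply: (@lipschitz_continuous _ _ _ _ `|w|) => z z'.
    by rewrite /b -amulBr; apply: le_trans (norm_amul _ _) _; rewrite norm_star.
  - by move=> w z; rewrite /b /L starM h_star amulA.
move=> v x; rewrite -(@ler_pXn2r _ 2) ?nnegrE ?mulr_ge0 ?invr_ge0 // exprMn.
rewrite -!inner_norm -subr_ge0 (_ : 2^-1 ^+ 2 = 4^-1); last by field.
have := inner_self_ge0 (pi (Y v) x).
rewrite repr_adjr -reprM -[_ ** _]/(b (Y v) (Y v)) -bY /Y quad_root_sq //.
rewrite /b reprM -repr_adjr.
rewrite (linearBE (repr_linearl x)) (linearZE (repr_linearl x)) innerBl innerZl.
rewrite /L /h -amulA !reprM -repr_adjr ?conj_Creal ?ger0_real ?invr_ge0 //.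
Qed.

(** Since [inner (pi c y) (pi c y) = inner (pi c^† (pi c y)) y], the bound for
    [c^†] at the vector [pi c y] yields the bound for [c] at every [y]. *)
Theorem repr_bound a x : `|pi a x| <= `|a| * `|x|.
Proof.
have half c y : `|c| <= 2^-1 -> `|pi c y| <= 2^-1 * `|y|.
  move=> c2; have [->|pc0] := eqVneq (pi c y) 0.
    by rewrite normr0 mulr_ge0 ?invr_ge0.
  rewrite -(@ler_pM2l _ `|pi c y|) ?normr_gt0 // -expr2 -inner_norm.
  rewrite -[inner _ _]ger0_norm ?inner_self_ge0 // repr_adjr.
  apply: le_trans (Cauchy_Schwarz _ _) _.
  rewrite [leRHS]mulrCA mulrA; apply: ler_wpM2r => //.
  by apply: repr_half_bound; rewrite norm_star.
have [->|a0] := eqVneq a 0.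
  by rewrite (linear0E (repr_linearl x)) !normr0 mul0r.
have na0 : `|a| != 0 by rewrite normr_eq0.
have := half ((2 * `|a|)^-1 *: a) x.
rewrite (linearZE (repr_linearl x)) !normrZ normfV normrM normr_id.
rewrite ger0_norm // invfM -!mulrA mulVf // mulr1 lexx => /(_ isT).
rewrite ler_pM2l ?invr_gt0 // mulrC ler_pdivrMr ?lt_def ?na0 ?normr_ge0 //.
by rewrite mulrC.
Qed.

End Representations.

(** * The absolute value of a symmetric operator and a Schur lemma *)

Section AbsoluteValue.
Context {R : realType} {H : hilbertType R}.
Variable T : H -> H.
Hypothesis linT : linear T.
Hypothesis symT : forall x y, inner (T x) y = inner x (T y).
Hypothesis boundT : forall x, `|T x| <= 2^-1 * `|x|.

(* By [boundT], [T ^+ 2] lies between 0 and 1/4, whence [defect_bound]. *)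
Let defect x := 4^-1 *: x - T (T x).

Let defect_linear : linear defect.
Proof.
move=> c x y; rewrite /defect !linT scalerDr scalerBr !scalerA [c * _]mulrC.
by rewrite opprD addrACA.
Qed.

Let defect_bound x : `|defect x| <= 4^-1 * `|x|.
Proof.
rewrite -(@ler_pXn2r _ 2) ?nnegrE ?mulr_ge0 ?invr_ge0 //.
rewrite exprMn -!inner_norm /defect innerBl !innerBr !innerZl !innerZr.
have -> : inner (T (T x)) (T (T x)) = `|T (T x)| ^+ 2 by rewrite inner_norm.
rewrite -!symT [inner (T (T x)) x]symT !inner_norm.
rewrite (conj_Creal (_ : 4^-1 \is Num.real)) ?ger0_real ?invr_ge0 //.
have : `|T (T x)| ^+ 2 <= 4^-1 * `|T x| ^+ 2.
  rewrite (_ : 4^-1 = 2^-1 ^+ 2); last by field.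
  by rewrite -exprMn ler_pXn2r ?nnegrE ?mulr_ge0 ?invr_ge0.
move: (`|x| ^+ 2) => a; have := exprn_ge0 2 (normr_ge0 (T x)).
move: (`|T x| ^+ 2) (`|T (T x)| ^+ 2) => t u t0 ut.
rewrite -subr_ge0 [X in 0 <= X](_ : _ = (4^-1 * t - u) + 4^-1 * t); last by field.
by rewrite addr_ge0 ?subr_ge0 // mulr_ge0 ?invr_ge0.
Qed.

Definition operator_abs : H -> H := quad_root defect.

Lemma operator_abs_linear : linear operator_abs.
Proof. exact: quad_root_linear defect_linear defect_bound. Qed.

Lemma operator_abs_sq x : operator_abs (operator_abs x) = T (T x).
Proof. by rewrite /operator_abs quad_root_sq // /defect subKr. Qed.

Lemma operator_abs_continuous : continuous operator_abs.
Proof.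
apply: (@lipschitz_continuous _ _ _ _ 1) => x y.
rewrite -(linearBE operator_abs_linear) mul1r /operator_abs /quad_root.
apply: le_trans (ler_normB _ _) _.
rewrite normrZ ger0_norm ?invr_ge0 //.
apply: le_trans (lerD (lexx _) (quad_lim_bound defect_linear defect_bound _)) _.
by rewrite -mulrDl [2^-1 + 2^-1](_ : _ = 1) ?mul1r //; field.
Qed.

Lemma operator_abs_comm (C : H -> H) : linear C -> continuous C ->
  (forall x, C (T x) = T (C x)) ->
  forall x, C (operator_abs x) = operator_abs (C x).
Proof.
move=> lC cC CT x; rewrite /operator_abs /quad_root (linearBE lC) (linearZE lC).
congr (_ - _); apply: (quad_lim_comm defect_linear defect_bound) => // y.
by rewrite /defect (linearBE lC) (linearZE lC) !CT.
Qed.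

(** This quantitative form of positivity, [B ^+ 2 <= B] for
    [B = 1/2 - Z], says that [`|Z x| <= 1/2 * `|x|]. It shows that [B x = 0]
    as soon as [inner (B x) x = 0]. *)
Lemma operator_abs_ge x :
  `|operator_abs x| ^+ 2 <= inner (operator_abs x) x.
Proof.
have sym y z : inner (quad_lim defect y) z = inner y (quad_lim defect z).
  apply: (quad_lim_pairing defect_linear defect_bound
    (b := fun u v => inner u v : R[i]^o)).
  - by move=> w u v; rewrite innerDl.
  - by move=> w u v; rewrite innerDr.
  - move=> w; apply: (@lipschitz_continuous _ _ _ _ `|w|) => u v.
    by rewrite -innerBr Cauchy_Schwarz.
  - exact: inner_continuousl.
  - move=> u v; rewrite /defect innerBl innerBr innerZl innerZr !symT.
    by rewrite conj_Creal ?ger0_real ?invr_ge0.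
have := quad_lim_bound defect_linear defect_bound x.
rewrite -(@ler_pXn2r _ 2) ?nnegrE ?mulr_ge0 ?invr_ge0 // exprMn.
rewrite -!inner_norm /operator_abs /quad_root !innerBl !innerBr !innerZl !innerZr.
rewrite -(sym x x) (conj_Creal (_ : 2^-1 \is Num.real)) ?ger0_real ?invr_ge0 //.
move: (inner (quad_lim _ _) (quad_lim _ _)) (inner (quad_lim _ _) x) (inner x x).
move=> u t a h.
rewrite -subr_ge0 [X in 0 <= X](_ : _ = 2^-1 ^+ 2 * a - u); last by field.
by rewrite subr_ge0.
Qed.

End AbsoluteValue.

Section ScalarSymmetric.
Context {R : realType} {H : hilbertType R}.

(** Let [c] be the mean value of [T] at [x0] and [B] the absolute value of
    [T - c]. The kernel of [B - (T - c)] in the range of [P] is stable, so it is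
    0 or everything, and [T - c = B] or [T - c = - B] at [x0]. As the mean value
    of [T - c] at [x0] is 0, positivity of [B] forces [B x0 = 0]. So the kernel
    of [T - c], which is stable too, is not 0. *)
Lemma symmetric_scalar (P T : H -> H) (G : set (H -> H)) (C : R[i]) (x0 : H) :
  linear P -> continuous P -> (forall x, P (T x) = T (P x)) ->
  linear T -> (forall x y, inner (T x) y = inner x (T y)) ->
  0 <= C -> (forall x, `|T x| <= C * `|x|) ->
  (forall g, G g -> [/\ linear g, continuous g,
    forall x, g (P x) = P (g x) & forall x, g (T x) = T (g x)]) ->
  (forall M : set H, closed_linear_subspace M -> M `<=` [set x | P x = x] ->
    (forall g x, G g -> M x -> M (g x)) -> (exists2 x, M x & x != 0) ->
    [set x | P x = x] `<=` M) ->
  P x0 = x0 -> `|x0| = 1 ->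
  forall x, P x = x -> T x = inner (T x0) x0 *: x.
Proof.
move=> lP cP PT lT symT C0 boundT hG irr Px0 x01.
set c := inner (T x0) x0.
have c_real : c^* = c by rewrite -innerC -symT.
(* [T'] is [T - c] rescaled to the norm bound of the absolute value *)
pose D := C + `|c| + 1.
have D0 : 0 < D by rewrite ltr_wpDl // addr_ge0.
pose l := (2 * D)^-1.
have l0 : 0 < l by rewrite invr_gt0 mulr_gt0.
have l_real : l^* = l by rewrite conj_Creal // ger0_real // ltW.
pose T' x := l *: (T x - c *: x).
have lT' : linear T'.
  move=> k x y; rewrite /T' lT [c *: (_ + _)]scalerDr opprD addrACA.
  rewrite [c *: (k *: x)]scalerA [c * k]mulrC -scalerA -scalerBr scalerDr.
  by rewrite !scalerA [l * k]mulrC.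
have symT' x y : inner (T' x) y = inner x (T' y).
  by rewrite /T' innerZl innerZr innerBl innerBr innerZl innerZr l_real c_real symT.
have boundT' x : `|T' x| <= 2^-1 * `|x|.
  rewrite /T' normrZ gtr0_norm // /l invfM -mulrA; apply: ler_wpM2l.
    by rewrite invr_ge0.
  rewrite mulrC ler_pdivrMr //; apply: le_trans (ler_normB _ _) _.
  rewrite normrZ; apply: le_trans (lerD (boundT x) (lexx _)) _.
  by rewrite -mulrDl mulrC; apply: ler_wpM2l => //; rewrite lerDl.
have cT' : continuous T'.
  by apply: (@lipschitz_continuous _ _ _ _ 2^-1) => x y; rewrite -(linearBE lT').
have commT' g : linear g -> (forall x, g (T x) = T (g x)) ->
    forall x, g (T' x) = T' (g x).
  by move=> lg gT x; rewrite /T' (linearZE lg) (linearBE lg) (linearZE lg) gT.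
pose B := operator_abs T'.
have lB : linear B := operator_abs_linear lT' symT' boundT'.
have cB : continuous B := operator_abs_continuous lT' symT' boundT'.
have BB x : B (B x) = T' (T' x) by exact: operator_abs_sq.
have commB g : linear g -> continuous g -> (forall x, g (T' x) = T' (g x)) ->
    forall x, g (B x) = B (g x).
  by move=> lg cg gT x; apply: operator_abs_comm.
have sK : closed_linear_subspace [set x | P x = x].
  by apply: equalizer_subspace => // x; exact: cvg_id.
have T'0 : inner (T' x0) x0 = 0.
  by rewrite innerZl innerBl innerZl inner_norm x01 expr1n mulr1 subrr mulr0.
have BT' : B x0 = T' x0 \/ B x0 = - T' x0.
  pose M := [set x | P x = x] `&` [set x | B x = T' x].
  have [[x Mx x0']|M0] := pselect (exists2 x, M x & x != 0).
    left; suff : M x0 by case.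
    apply: irr Px0; last by exists x.
    - by apply: setI_subspace => //; apply: equalizer_subspace.
    - by move=> y [].
    - move=> g y /hG[lg cg gP gT] [/= Py By]; split=> /=; first by rewrite -gP Py.
      by rewrite -(commB g lg cg (commT' g lg gT)) By commT'.
  (* [(B - T') (B + T') = 0], so [B x0 + T' x0] lies in the zero subspace [M] *)
  right; apply/eqP; rewrite -addr_eq0; apply/negPn/negP => nz.
  apply: M0; exists (B x0 + T' x0) => //; split=> /=.
    by rewrite (linearDE lP) (commB P lP cP (commT' P lP PT)) commT' // Px0.
  by rewrite (linearDE lB) (linearDE lT') BB -[B (T' x0)](commB T') // addrC.
have B0 : B x0 = 0.
  have : inner (B x0) x0 = 0.
    by case: BT' => ->; rewrite ?T'0 // -scaleN1r innerZl T'0 mulr0.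
  have := operator_abs_ge lT' symT' boundT' x0; rewrite -/B => le0 e0.
  apply: inner_self_eq0; apply: le_anti.
  by rewrite inner_self_ge0 inner_norm andbT -e0.
have T'x0 : T' x0 = 0.
  by case: BT'; rewrite B0 => /esym/eqP; rewrite ?oppr_eq0 => /eqP.
pose M := [set x | P x = x] `&` [set x | T' x = 0].
move=> x Px; have [_ /= /eqP] : M x.
  apply: irr Px; last first.
  - by exists x0 => //; rewrite -normr_gt0 x01.
  - move=> g y /hG[lg cg gP gT] [/= Py Ty]; split=> /=; first by rewrite -gP Py.
    by rewrite -commT' // Ty linear0E.
  - by move=> y [].
  - apply: setI_subspace => //.
    exact: (preimage_subspace lT' cT' (@set0_subspace _ H)).
by rewrite scaler_eq0 gt_eqF //= subr_eq0 => /eqP.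
Qed.

End ScalarSymmetric.

(** * Unitary operators between spaces with matching bases *)

Section IsometricExtension.
Context {R : realType} {H F : hilbertType R} {I : Type}.
Variables (D : I -> Prop) (f : I -> H) (e : I -> F).
Hypothesis gram : forall i j, D i -> D j -> inner (f i) (f j) = inner (e i) (e j).
Hypothesis total_f : forall W : set H, closed_linear_subspace W ->
  (forall i, D i -> W (f i)) -> W = setT.

(** The closed linear relation generated by the pairs [(f i, e i)]. It is the
    graph of the extension: equality of Gram matrices makes it isometric, hence
    single-valued, and completeness of [F] makes it total. *)
Let graph : set (H * F)%type :=
  closed_span [set p | exists2 i, D i & p = (f i, e i)].

Let equal_inner_subspace (x : H) (y : F) :
  closed_linear_subspace
    [set p : (H * F)%type | inner p.1 x = inner p.2 y].
Proof.
split.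
- have cfst : continuous (@fst H F) by move=> p; exact: cvg_fst.
  have csnd : continuous (@snd H F) by move=> p; exact: cvg_snd.
  apply: (@closed_equalizer _ _ R[i]^o) => p.
    exact: (continuous_comp (@cfst p) (@inner_continuousl _ _ x p.1)).
  exact: (continuous_comp (@csnd p) (@inner_continuousl _ _ y p.2)).
- by rewrite /= !inner0l.
- by move=> c p p' /= pxy p'xy; rewrite !innerDl !innerZl pxy p'xy.
Qed.

Let graph_isometric p p' : graph p -> graph p' ->
  inner p.1 p'.1 = inner p.2 p'.2.
Proof.
move=> Gp Gp'.
(* first against the generators in one argument, then in both *)
have step i q : D i -> graph q -> inner q.1 (f i) = inner q.2 (e i).
  move=> Di; apply: (closed_span_sub (equal_inner_subspace (f i) (e i))).
  by move=> _ [j Dj ->]; apply: gram.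
apply: (closed_span_sub (equal_inner_subspace p'.1 p'.2)) Gp.
move=> _ [i Di ->] /=; rewrite innerC [RHS]innerC; congr (Num.conj _).
exact: step.
Qed.

Let graph_linear := closed_span_subspace [set p | exists2 i, D i & p = (f i, e i)].

Let graph_norm p : graph p -> `|p.1| = `|p.2|.
Proof.
move=> Gp; apply/eqP; rewrite -(@eqrXn2 _ 2) // -!inner_norm; apply/eqP.
exact: graph_isometric.
Qed.

Let graph_total x : exists y, graph (x, y).
Proof.
suff dom : [set x | exists y, graph (x, y)] = setT by have : setT x by []; rewrite -dom.
apply: total_f; last first.
  by move=> i Di; exists (e i); apply: sub_closed_span; exists i.
have [closed_graph graph0 graphP] := graph_linear.
split; last 2 first.
- by exists 0.
- by move=> c u v [y Gy] [z Gz]; exists (c *: y + z); apply: (graphP c (u, y) (v, z)).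
apply/closed_approxP => u approx.
have /choice[p hp] (k : nat) : exists p, graph p /\ `|u - p.1| <= k.+1%:R^-1.
  have [|v [y Gy] uv] := approx k.+1%:R^-1; first by rewrite invr_gt0 ltr0n.
  by exists (v, y); split=> //; apply: ltW.
have dist k m : (k <= m)%N -> `|(p k).2 - (p m).2| <= 2 / k.+1%:R.
  move=> km; rewrite -[_ - _]/((p k - p m).2) -graph_norm; last first.
    exact: (subspaceB graph_linear (hp k).1 (hp m).1).
  rewrite /= -(subrKA u); apply: le_trans (ler_normD _ _) _.
  rewrite mulr_natl mulr2n; apply: lerD; first by rewrite distrC (hp k).2.
  apply: le_trans (hp m).2 _.
  by rewrite lef_pV2 ?posrE ?ltr0n // ler_nat.
have /cvg_ex[y py] : cvg ((fun k => (p k).2) @ \oo) by exact: cauchy_rate dist.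
have pu : (fun k => (p k).1) @ \oo --> u.
  by apply: (@cvg_rate _ _ _ _ 1) => // k; rewrite mul1r (hp k).2.
exists y; apply: (closed_cvg (F := \oo) (u_ := p) graph closed_graph).
  by near=> k; apply: (hp k).1.
have -> : p = (fun k => ((p k).1, (p k).2)) by apply/funext => k; case: (p k).
exact: cvg_pair.
Unshelve. all: by end_near.
Qed.

Lemma isometric_extension : exists U : H -> F,
  [/\ linear U, forall x y, inner (U x) (U y) = inner x y &
      forall i, D i -> U (f i) = e i].
Proof.
have [closed_graph graph0 graphP] := graph_linear.
have /choice[U hU] := graph_total; exists U.
have fun_graph x y z : graph (x, y) -> graph (x, z) -> y = z.
  move=> Gy Gz; apply/subr0_eq/eqP; rewrite -normr_eq0.
  rewrite -[y - z]/(((x, y) - (x, z)).2) -graph_norm; last first.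
    exact: (subspaceB graph_linear Gy Gz).
  by rewrite /= subrr normr0.
split.
- move=> c x y; apply: fun_graph (hU _) _.
  exact: (graphP c _ _ (hU x) (hU y)).
- by move=> x y; rewrite -(graph_isometric (hU x) (hU y)).
- by move=> i Di; apply: fun_graph (hU _) _; apply: sub_closed_span; exists i.
Qed.

End IsometricExtension.

Section Unitary.
Context {R : realType} {H F : hilbertType R} {I : Type}.
Variables (D : I -> Prop) (f : I -> H) (e : I -> F).

Lemma isometry_continuous (K L : hilbertType R) (U : K -> L) :
  linear U -> (forall x y, inner (U x) (U y) = inner x y) -> continuous U.
Proof.
move=> lU iU; apply: (@lipschitz_continuous _ _ _ _ 1) => x y.
rewrite -(linearBE lU) mul1r -(@ler_pXn2r _ 2) ?nnegrE // -!inner_norm.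
by rewrite iU.
Qed.

Lemma unitary_of_bases :
  (forall i j, D i -> D j -> inner (f i) (f j) = inner (e i) (e j)) ->
  (forall W : set H, closed_linear_subspace W ->
    (forall i, D i -> W (f i)) -> W = setT) ->
  (forall W : set F, closed_linear_subspace W ->
    (forall i, D i -> W (e i)) -> W = setT) ->
  exists (U : H -> F) (V : F -> H),
  [/\ linear U /\ linear V,
      forall x y, inner (U x) (U y) = inner x y,
      forall i, D i -> U (f i) = e i,
      cancel U V & cancel V U].
Proof.
move=> gram total_f total_e.
have [U [lU iU Uf]] := isometric_extension gram total_f.
have [|V [lV iV Ve]] := isometric_extension (D := D) (f := e) (e := f) _ total_e.
  by move=> i j Di Dj; rewrite gram.
have cU := isometry_continuous lU iU; have cV := isometry_continuous lV iV.
exists U, V; split=> // x.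
- suff : [set x | V (U x) = x] x by [].
  rewrite (_ : [set x | V (U x) = x] = setT) //; apply: total_f => /=.
    apply: equalizer_subspace => //.
    + by move=> c u v; rewrite lU lV.
    + by move=> u; apply: continuous_comp; [exact: cU|exact: cV].
    + by move=> u; exact: cvg_id.
  by move=> i Di; rewrite Uf ?Ve.
- suff : [set x | U (V x) = x] x by [].
  rewrite (_ : [set x | U (V x) = x] = setT) //; apply: total_e => /=.
    apply: equalizer_subspace => //.
    + by move=> c u v; rewrite lV lU.
    + by move=> u; apply: continuous_comp; [exact: cV|exact: cU].
    + by move=> u; exact: cvg_id.
  by move=> i Di; rewrite Ve ?Uf.
Qed.

End Unitary.

(** * The vacuum of an irreducible representation *)

Section GeneratedAlgebra.
Context {R : realType} {O : cstarAlgType R} {s : nat -> O}.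
Hypothesis generating : forall B : set O,
  closed_star_subalgebra B -> (forall i, B (s i)) -> B = setT.
Context {H : hilbertType R} {PI : O -> H -> H}.
Hypothesis repr_PI : representation PI.

Lemma star_preimage_subspace (B : set O) :
  closed_linear_subspace B -> closed_linear_subspace [set a | B a^†].
Proof.
move=> [cB B0 Bl]; split.
- apply: (@preimage_closed _ _ (@star R O)) => // a _.
  apply: (@lipschitz_continuous _ _ _ _ 1) => b c.
  by rewrite -starB norm_star mul1r.
- by rewrite /= -[0](subrr 0) starB subrr.
- by move=> c a b /= Ba Bb; rewrite starD starZ; apply: Bl.
Qed.

(** With [W = N] this says that a subspace stable under the generators is
    stable; with [W] everything and [N = 0], that a representation killing the
    generators is 0. *)
Lemma generators_map_into (W N : set H) :
  closed_linear_subspace N -> N `<=` W ->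
  (forall i x, W x -> N (PI (s i) x)) ->
  (forall i x, W x -> N (PI (s i)^† x)) ->
  forall a x, W x -> N (PI a x).
Proof.
move=> sN NW sW s'W.
pose B := \bigcap_(x in W) [set a | N (PI a x)].
have sB : closed_linear_subspace B.
  apply: bigcap_subspace => x _; apply: (preimage_subspace _ _ sN).
    exact: (repr_linearl repr_PI).
  apply: (@lipschitz_continuous _ _ _ _ `|x|) => a b.
  rewrite -(linearBE (repr_linearl repr_PI x)) mulrC.
  exact: (repr_bound repr_PI).
suff BT : B `&` [set a | B a^†] = setT.
  move=> a x Wx; have [/(_ _ Wx)] : (B `&` [set a | B a^†]) a by rewrite BT.
  by [].
apply: generating => [|i]; last by split=> x Wx /=; [apply: sW|apply: s'W].
split.
- by apply: setI_subspace => //; apply: star_preimage_subspace.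
- move=> a b [Ba Ba'] [Bb Bb']; split=> x Wx /=.
    by rewrite (reprM repr_PI); apply/Ba/NW/Bb.
  by rewrite starM (reprM repr_PI); apply/Bb'/NW/Ba'.
- by move=> a [Ba Ba']; split=> //=; rewrite starK.
Qed.

End GeneratedAlgebra.

Section Structure.
Context {R : realType} {O : cstarAlgType R} {s : nat -> O}.
Hypothesis relations : OAN_relations s.
Hypothesis generating : forall B : set O,
  closed_star_subalgebra B -> (forall i, B (s i)) -> B = setT.
Context {H : hilbertType R} {PI : O -> H -> H}.
Hypothesis irr_PI : irreducible PI.

Let repr_PI : representation PI. Proof. by case: irr_PI. Qed.

Local Notation S i := (PI (s i)).
Local Notation S' i := (PI (s i)^†).

Let S_linear i : linear (S i). Proof. exact: repr_linear repr_PI _. Qed.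
Let S'_linear i : linear (S' i). Proof. exact: repr_linear repr_PI _. Qed.
Let S0E i : S i 0 = 0. Proof. exact: linear0E (S_linear i). Qed.

Let SS'S i x : S i (S' i (S i x)) = S i x.
Proof. by rewrite -!(reprM repr_PI); have [-> _ _] := relations. Qed.

Let S'SS' i x : S' i (S i (S' i x)) = S' i x.
Proof.
rewrite -!(reprM repr_PI); congr (PI _ x).
have [/(_ i)/(congr1 star)] := relations.
by rewrite !starM starK -amulA.
Qed.

Let S'S_orth i j x : i != j -> S' i (S j x) = 0.
Proof.
move=> ij; rewrite -(reprM repr_PI); have [_ -> // _] := relations.
exact: linear0E (repr_linearl repr_PI x).
Qed.

Let S'S_sum i x : S' i (S i x) = \sum_(k < i.+1) S k (S' k x).
Proof.
rewrite -(reprM repr_PI); have [_ _ ->] := relations.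
elim/big_rec2: _ => [|k y a _ <-]; first exact: linear0E (repr_linearl repr_PI x).
by rewrite (linearDE (repr_linearl repr_PI x)) (reprM repr_PI).
Qed.

Lemma first_nonzero_generator :
  exists n, (exists x, S n x != 0) /\ forall k x, (k < n)%N -> S k x = 0.
Proof.
have ex_n : exists m, `[< exists x, S m x != 0 >].
  apply: contrapT => no.
  have S_0 i x : S i x = 0.
    apply/eqP/negPn/negP => nz; apply: no; exists i; apply/asboolP.
    by exists x.
  have [_ [a [x PIax]] _] := irr_PI; apply: PIax.
  apply: (generators_map_into generating repr_PI (W := setT) (N := [set 0])) => //.
  - exact: set0_subspace.
  - by move=> i y _; exact: S_0.
  - move=> i y _ /=; apply: inner_self_eq0.
    by rewrite (repr_adjr repr_PI) starK S_0 inner0l.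
case: (ex_minnP ex_n) => n /asboolP hn min; exists n; split=> // k x kn.
apply/eqP/negPn/negP => nz; have : (n <= k)%N by apply: min; apply/asboolP; exists x.
by rewrite leqNgt kn.
Qed.

Section FirstGenerator.
Variable n : nat.
Hypothesis S_n_neq0 : exists x, S n x != 0.
Hypothesis S_lt_n : forall k x, (k < n)%N -> S k x = 0.

Let P x := S n (S' n x).

Let S'S_n x : S' n (S n x) = P x.
Proof.
by rewrite S'S_sum big_ord_recr /= big1 ?add0r // => k _; exact: S_lt_n.
Qed.

Let P_linear : linear P.
Proof. by move=> c x y; rewrite /P S'_linear S_linear. Qed.

Let P_continuous : continuous P.
Proof.
move=> x; apply: continuous_comp; exact: (repr_continuous repr_PI).
Qed.

Let PS x : P (S n x) = S n x. Proof. exact: SS'S. Qed.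
Let SP x : S n (P x) = S n x. Proof. by rewrite -S'S_n SS'S. Qed.
Let PS' x : P (S' n x) = S' n x. Proof. by rewrite -S'S_n S'SS'. Qed.
Let S'P x : S' n (P x) = S' n x. Proof. exact: S'SS'. Qed.
Let PP x : P (P x) = P x. Proof. by rewrite {2}/P PS. Qed.

Let P_sym x y : inner (P x) y = inner x (P y).
Proof. by rewrite /P !(repr_adj repr_PI) starK. Qed.

Let S'_orth k x : k != n -> P x = x -> S' k x = 0.
Proof. by move=> kn <-; apply: S'S_orth. Qed.

(** The vector playing the role of the word [w] when [x] plays the role of the
    vacuum; letters are shifted by [n]. *)
Definition word_vector (w : seq nat) (x : H) : H :=
  foldr (fun i => S (n + i)%N) x w.
Local Notation fw := word_vector.

(* The vector [fw w x] lies in the range of [S (n + head 0 w)], also for the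
   empty word because [x] lies in the range of [S n]. *)
Let fw_range w x : P x = x ->
  S (n + head 0%N w)%N (S' (n + head 0%N w)%N (fw w x)) = fw w x.
Proof. by case: w => [|j w] Px /=; rewrite ?addn0 ?SS'S. Qed.

Let fw_orth w x k : P x = x -> k != (n + head 0%N w)%N -> S' k (fw w x) = 0.
Proof.
by case: w => [|j w] Px /=; rewrite ?addn0 => kn; [apply: S'_orth|apply: S'S_orth].
Qed.

(* Exactly one term of the sum for [(S m)^† (S m)] can act nontrivially on
   [fw w x], and it occurs when the first letter is small enough. *)
Let S'S_fw w x m : P x = x ->
  S' m (S m (fw w x)) = if (n + head 0%N w <= m)%N then fw w x else 0.
Proof.
move=> Px; rewrite S'S_sum; case: leqP => hm.
  rewrite (bigD1 (Ordinal (hm : n + head 0%N w < m.+1)%N)) //= fw_range //.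
  rewrite big1 ?addr0 // => k; rewrite -val_eqE /= => kh.
  by rewrite fw_orth // S0E.
rewrite big1 // => k _; rewrite fw_orth ?S0E // neq_ltn.
by rewrite (leq_ltn_trans _ hm) // -ltnS.
Qed.

Let S_fw w x m : P x = x ->
  S m (fw w x) = if (n + head 0%N w <= m)%N then S m (fw w x) else 0.
Proof.
by move=> Px; case: leqP => // hm; rewrite -SS'S S'S_fw // leqNgt hm S0E.
Qed.

Let wm_cons i w : (1 <= i)%N -> wm_word w -> (head 0%N w <= i)%N ->
  wm_word (i :: w).
Proof.
rewrite /wm_word /= => i1 /andP[sw aw] hw; rewrite i1 aw !andbT.
by case: w sw hw {aw} => //= j w -> ->.
Qed.

Let wm_consP i w : wm_word (i :: w) ->
  [/\ (1 <= i)%N, wm_word w & (head 0%N w <= i)%N].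
Proof.
rewrite /wm_word /= => /andP[pw /andP[i1 aw]]; split=> //.
  by rewrite aw andbT; exact: path_sorted pw.
by case: w pw {aw} => //= j w /andP[].
Qed.

Let word_vectors (M : set H) : set H :=
  [set y | exists w x, [/\ wm_word w, M x & y = fw w x]].

(** The operators [S n] and [S' n] kill the vectors of nonempty words and
    preserve [M], while the other generators and their adjoints add or remove
    a letter, or give 0.
    So the span of the word vectors over [M] is stable, hence the whole space,
    and [P] maps it into [M]. *)
Lemma vacuum_subspace (M : set H) :
  closed_linear_subspace M -> M `<=` [set x | P x = x] ->
  (forall x, M x -> M (S n x)) -> (forall x, M x -> M (S' n x)) ->
  (exists2 x, M x & x != 0) ->
  closed_span (word_vectors M) = setT /\ [set x | P x = x] `<=` M.
Proof.
move=> sM MP SM S'M [x0 Mx0 x00].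
have M0 : M 0 by case: sM.
pose X := word_vectors M.
have span0 : closed_span X 0 by case: (closed_span_subspace X).
have XS i x : X x -> closed_span X (S i x).
  move=> [w [y [wmw My ->]]]; have Py := MP y My.
  rewrite S_fw //; case: leqP => // hi.
  apply: sub_closed_span; move: (hi).
  rewrite -(subnKC (leq_trans (leq_addr _ _) hi)) leq_add2l.
  move: (i - n)%N => j; case: (posnP j) => [->|j1] hj; last first.
    by exists (j :: w), y; split=> //; apply: wm_cons.
  case: w wmw hj {hi} => [|a w] wmw hj.
    by rewrite addn0; exists [::], (S n y); split=> //; apply: SM.
  by have [a1] := wm_consP wmw; move: hj; rewrite leqn0 => /eqP /= a0; rewrite a0 in a1.
have XS' i x : X x -> closed_span X (S' i x).
  move=> [w [y [wmw My ->]]]; have Py := MP y My.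
  case: w wmw => [|j w] wmw /=.
    have [->|ni] := eqVneq i n; last by rewrite S'_orth.
    by apply: sub_closed_span; exists [::], (S' n y); split=> //; apply: S'M.
  have [->|ni] := eqVneq i (n + j)%N; last by rewrite S'S_orth.
  have [j1 wm_w hw] := wm_consP wmw.
  rewrite S'S_fw // leq_add2l hw.
  by apply: sub_closed_span; exists w, y.
have Pspan : forall x, closed_span X x -> M (P x).
  apply: (closed_span_sub (preimage_subspace P_linear P_continuous sM)).
  move=> _ [[|j w] [y [wmw My ->]]] /=; first by rewrite (MP y My).
  have [j1 _ _] := wm_consP wmw.
  by rewrite /P S'S_orth ?S0E // -[X in X != _]addn0 eqn_add2l eq_sym -lt0n.
have XT : closed_span X = setT.
  have [_ _ /(_ (closed_span X) (closed_span_subspace X))[||//]] := irr_PI.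
    apply: (generators_map_into generating repr_PI) => //.
    - exact: closed_span_subspace.
    - move=> i x; apply: closed_span_stable => //; first exact: (repr_continuous repr_PI).
      by move=> y; apply: XS.
    - move=> i x; apply: closed_span_stable => //; first exact: (repr_continuous repr_PI).
      by move=> y; apply: XS'.
  move=> X0; have : closed_span X x0 by apply: sub_closed_span; exists [::], x0.
  by rewrite X0 /= => x0_eq0; rewrite x0_eq0 eqxx in x00.
split=> // x /= <-; apply: Pspan; by rewrite XT.
Qed.

(** The real and imaginary parts of [S n] commute with [S n] and its adjoint
    because [S n] is normal, and by [vacuum_subspace] these two operators act
    irreducibly on the range of [P]. *)
Lemma vacuum_scalar : exists (x0 : H) (z : R[i]),
  [/\ P x0 = x0, `|x0| = 1, `|z| = 1 & forall x, P x = x -> S n x = z *: x].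
Proof.
have [y Sy0] := S_n_neq0.
pose x0 := `|S n y|^-1 *: S n y.
have Px0 : P x0 = x0 by rewrite (linearZE P_linear) PS.
have x01 : `|x0| = 1 by rewrite normrZ normfV normr_id mulVf // normr_eq0.
have normal x : S n (S' n x) = S' n (S n x) by rewrite S'S_n.
have scalar (t : O) : t^† = t ->
    (forall x, S n (PI t x) = PI t (S n x)) ->
    (forall x, S' n (PI t x) = PI t (S' n x)) ->
    exists c, forall x, P x = x -> PI t x = c *: x.
  move=> t_sa tS tS'; exists (inner (PI t x0) x0).
  apply: (symmetric_scalar (G := [set g | g = S n \/ g = S' n]) (C := `|t|)) => //.
  - by move=> x; rewrite /P tS' tS.
  - exact: (repr_linear repr_PI).
  - by move=> x y'; rewrite (repr_adj repr_PI) t_sa.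
  - exact: (repr_bound repr_PI).
  - move=> g [->|->]; split=> //; try exact: (repr_continuous repr_PI).
      by move=> x; rewrite SP PS.
    by move=> x; rewrite S'P PS'.
  - move=> M sM MP MG Mnz; apply: (vacuum_subspace sM MP _ _ Mnz).2 => x Mx.
      by apply: MG Mx; left.
    by apply: MG Mx; right.
pose re := s n + (s n)^†; pose im := 'i *: (s n - (s n)^†).
have reE x : PI re x = S n x + S' n x.
  exact: (linearDE (repr_linearl repr_PI x)).
have imE x : PI im x = 'i *: (S n x - S' n x).
  rewrite (linearZE (repr_linearl repr_PI x)).
  by rewrite (linearBE (repr_linearl repr_PI x)).
have [c hc] : exists c, forall x, P x = x -> PI re x = c *: x.
  apply: scalar => [|x|x]; first by rewrite /re starD starK addrC.
    by rewrite !reE (linearDE (S_linear n)) normal.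
  by rewrite !reE (linearDE (S'_linear n)) normal.
have [d hd] : exists c, forall x, P x = x -> PI im x = c *: x.
  apply: scalar => [|x|x].
  - rewrite /im starZ starB starK -[_ - s n]opprB scalerN -scaleNr.
    by rewrite conjCi opprK.
  - by rewrite !imE (linearZE (S_linear n)) (linearBE (S_linear n)) normal.
  - by rewrite !imE (linearZE (S'_linear n)) (linearBE (S'_linear n)) normal.
pose z := 2^-1 * (c - 'i * d); exists x0, z.
have Sz x : P x = x -> S n x = z *: x.
  move=> Px; rewrite /z -scalerA scalerBl -scalerA -hc // -hd // reE imE.
  rewrite scalerA -expr2 sqrCi scaleN1r opprK addrACA subrr addr0.
  by rewrite scalerDr -scalerDl [2^-1 + 2^-1](_ : _ = 1) ?scale1r //; field.
split=> //.
have : inner (S n x0) (S n x0) = 1.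
  by rewrite (repr_adjr repr_PI) S'S_n Px0 inner_norm x01 expr1n.
rewrite inner_norm Sz // normrZ x01 mulr1 => /eqP.
by rewrite sqrp_eq1 // => /eqP.
Qed.

(** The line through a vacuum vector is now itself stable under [S n] and its
    adjoint, so its word vectors are total; also, the range of [P] is that line,
    which determines [S n]. *)
Lemma word_basis : exists (x0 : H) (z : R[i]),
  [/\ `|z| = 1, S n x0 = z *: x0, x0 != 0,
      forall x, S n x = (z * inner x x0) *: x0 &
      [/\ forall v w, wm_word v -> wm_word w ->
             inner (fw v x0) (fw w x0) = (v == w)%:R,
          forall W, closed_linear_subspace W ->
             (forall w, wm_word w -> W (fw w x0)) -> W = setT &
          forall i w, (1 <= i)%N -> S (n + i)%N (fw w x0) =
             if (head 0%N w <= i)%N then fw (i :: w) x0 else 0]].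
Proof.
have [x0 [z [Px0 x01 z1 Sz]]] := vacuum_scalar; exists x0, z.
have x00 : x0 != 0 by rewrite -normr_gt0 x01.
pose M := [set y | y = inner y x0 *: x0].
have M0 c : M (c *: x0) by rewrite /M /= innerZl inner_norm x01 expr1n mulr1.
have S'x0 : S' n x0 = z^-1 *: x0.
  rewrite -[LHS]scale1r -(mulVf (_ : z != 0)) -?normr_gt0 ?z1 // -scalerA.
  by rewrite -(linearZE (S'_linear n)) -Sz // S'S_n Px0.
have [|||||span PM] := @vacuum_subspace M.
- exact: line_subspace.
- by move=> x /= ->; rewrite (linearZE P_linear) Px0.
- by move=> x ->; rewrite (linearZE (S_linear n)) Sz // scalerA.
- by move=> x ->; rewrite (linearZE (S'_linear n)) S'x0 scalerA.
- by exists x0 => //; rewrite -[x0]scale1r; apply: M0.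
split=> //; first exact: Sz.
  move=> x; rewrite -SP Sz ?PP // -scalerA; congr (_ *: _).
  by have /= {1}-> := PM (P x) (PP x); rewrite P_sym Px0.
have fwZ w c : fw w (c *: x0) = c *: fw w x0.
  by elim: w => //= i w ->; rewrite (linearZE (S_linear _)).
split.
- elim=> [|i v IH] [|j w] wmv wmw /=.
  + by rewrite inner_norm x01 expr1n.
  + have [j1 _ _] := wm_consP wmw.
    rewrite (repr_adjr repr_PI) S'_orth ?inner0l //.
    by rewrite -[X in _ != X]addn0 eqn_add2l -lt0n.
  + have [i1 _ _] := wm_consP wmv.
    rewrite (repr_adj repr_PI) S'_orth ?inner0r //.
    by rewrite -[X in _ != X]addn0 eqn_add2l -lt0n.
  have [i1 wm_v hv] := wm_consP wmv; have [j1 wm_w hw] := wm_consP wmw.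
  rewrite (repr_adjr repr_PI) eqseq_cons.
  have [ij|ij] := eqVneq i j.
    by rewrite -ij S'S_fw // leq_add2l hv IH.
  by rewrite S'S_orth ?inner0l // eqn_add2l eq_sym.
- move=> W sW Ww; apply/seteqP; split=> // x _.
  have : closed_span (word_vectors M) x by rewrite span.
  move: x; apply: (closed_span_sub sW) => _ [w [y [wmw My ->]]].
  by rewrite My fwZ; apply: (subspaceZ sW); apply: Ww.
- by move=> i w i1; rewrite S_fw // leq_add2l.
Qed.

End FirstGenerator.
End Structure.

(** * Transport to Fock space *)

Section Transport.
Context {R : realType}.

Lemma repr_comp (O Q : cstarAlgType R) (q : O -> Q) (H : hilbertType R)
    (pi : Q -> H -> H) :
  star_hom q -> representation pi -> representation (fun a => pi (q a)).
Proof.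
move=> [lq qM qS] [bpi lpi Mpi Spi]; split=> [a|c a b x|a b x|a x y].
- exact: bpi.
- by rewrite lq lpi.
- by rewrite qM Mpi.
- by rewrite Spi qS.
Qed.

Lemma irreducible_comp (O Q : cstarAlgType R) (q : O -> Q) (H : hilbertType R)
    (pi : Q -> H -> H) :
  star_hom q -> (forall b, exists a, q a = b) ->
  irreducible pi -> irreducible (fun a => pi (q a)).
Proof.
move=> qh qs [rpi [b [x pix]] irr]; split; first exact: repr_comp.
  by have [a qa] := qs b; exists a, x; rewrite qa.
move=> W sW stW; apply: irr => // c y Wy.
by have [a <-] := qs c; apply: stW.
Qed.

Lemma repr_conj (Q : cstarAlgType R) (H F : hilbertType R)
    (pi : Q -> H -> H) (U : H -> F) (V : F -> H) :
  linear U -> linear V -> (forall x y, inner (U x) (U y) = inner x y) ->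
  cancel U V -> cancel V U -> representation pi ->
  representation (fun a y => U (pi a (V y))).
Proof.
move=> lU lV iU UV VU rpi.
have iV x y : inner (V x) (V y) = inner x y by rewrite -iU !VU.
split=> [a|c a b x|a b x|a x y].
- split.
    by move=> c x y; rewrite lV (repr_linear rpi) lU.
  have cU := isometry_continuous lU iU; have cV := isometry_continuous lV iV.
  have cpi := repr_continuous rpi (a := a).
  by move=> x; exact: (continuous_comp (continuous_comp (cV x) (cpi _)) (cU _)).
- by rewrite (repr_linearl rpi) lU.
- by rewrite UV (reprM rpi).
- by rewrite -[y in LHS]VU iU (repr_adj rpi) -iU VU.
Qed.

End Transport.

Theorem corollary3p12 (R : realType)
    (O : cstarAlgType R) (s : nat -> O) (hO : is_OAN s)
    (Q : cstarAlgType R) (q : O -> Q)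
    (hQ : is_quotient
      (closed_ideal_generated [set s 0%N - s 0%N ** (s 0%N)^†]) q)
    (F : hilbertType R) (e : seq nat -> F) (hF : is_wm_Fock_space e)
    (Ad : nat -> F -> F) (hAd : forall i, (1 <= i)%N -> is_creation e i (Ad i))
    (H : hilbertType R) (pi : Q -> H -> H) (hpi : irreducible pi) :
  (exists piF : Q -> F -> F,
    [/\ representation piF,
        is_Fock_representation s e Ad (fun a => piF (q a)) &
        unitarily_equivalent pi piF]) \/
  (exists (n : nat) (z : R[i]) (rho : Q -> F -> F),
    [/\ (1 <= n)%N /\ `|z| = 1,
        representation rho,
        is_pi_tilde s e Ad n z (fun a => rho (q a)) &
        unitarily_equivalent pi rho]).
Proof.
have [rel gen _] := hO; have [qh qsurj qker _ _] := hQ.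
have [ortho_e total_e] := hF.
have rpi : representation pi by case: hpi.
pose PI a := pi (q a).
have irrPI : irreducible PI by exact: irreducible_comp.
have rPI : representation PI by case: irrPI.
have [n [Sn0 Sltn]] := first_nonzero_generator gen irrPI.
have [x0 [z [z1 Sx0 x00 Sn [ortho_f total_f S_f]]]] :=
  word_basis rel gen irrPI Sn0 Sltn.
pose f w := word_vector (s := s) (PI := PI) n w x0.
have [|U [V [[lU lV] iU Uf UV VU]]] :=
    @unitary_of_bases R H F (seq nat) wm_word f e _ total_f total_e.
  by move=> v w wmv wmw; rewrite ortho_f // ortho_e.
have Ux0 : U x0 = e [::] by rewrite -(Uf [::]).
pose rho a y := U (pi a (V y)).
have rrho : representation rho by apply: (repr_conj (U := U) (V := V)).
have tilde : is_pi_tilde s e Ad n z (fun a => rho (q a)).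
  split=> [|i y ni|y|i y i1].
  - exact: repr_comp.
  - by rewrite /rho -[pi _ _]/(PI (s i) (V y)) Sltn // linear0E.
  - rewrite /rho -[pi _ _]/(PI (s n) (V y)) Sn (linearZE lU) Ux0.
    by rewrite /vacuum_projection scalerA -Ux0 -[y in RHS]VU iU.
  - have [[lAd cAd] Ade] := hAd i i1.
    suff : [set y | rho (q (s (n + i)%N)) y = Ad i y] y by [].
    rewrite (_ : [set y | _] = setT) //; apply: total_e => [|w wmw] /=.
      have [/(_ (q (s (n + i)%N)))[lrho crho] _ _ _] := rrho.
      exact: equalizer_subspace.
    rewrite Ade // /rho -(Uf w wmw) UV -[pi _ _]/(PI (s (n + i)%N) (f w)) S_f //.
    case: ifP => hw; last exact: linear0E.
    rewrite -[word_vector _ _ _]/(f (i :: w)) Uf //.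
    move: wmw; rewrite /wm_word /= i1 => /andP[sw ->]; rewrite !andbT.
    by case: w sw hw => //= j w -> ->.
have equiv : unitarily_equivalent pi rho.
  exists U; split=> // [y|a x]; first by exists (V y); rewrite VU.
  by rewrite /rho UV.
have [n0|n1] := posnP n; last by right; exists n, z, rho.
left; exists rho; split=> //.
rewrite /is_Fock_representation; suff <- : z = 1 by rewrite -{1}n0.
(* modulo the ideal [s 0] is a self-adjoint idempotent, so [z = z ^+ 2] *)
have qs0 : q (s 0%N) = q (s 0%N ** (s 0%N)^†).
  apply/subr0_eq; have [lq _ _] := qh; rewrite -(linearBE lq).
  by apply/qker => I _ gensI; apply: gensI.
have qs0_idem : PI (s 0%N) x0 = PI (s 0%N) (PI (s 0%N) x0).
  have [_ qM qS] := qh.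
  have q_sa : q (s 0%N)^† = q (s 0%N) by rewrite qS qs0 -qS starM starK.
  by rewrite /PI {1}qs0 qM q_sa (reprM rpi).
move: Sx0; rewrite n0 => Sx0.
move: qs0_idem; rewrite Sx0 (linearZE (repr_linear rPI _)) Sx0 scalerA.
move=> /eqP; rewrite -subr_eq0 -scalerBl scaler_eq0 (negPf x00) orbF.
rewrite -[X in X - _]mulr1 -mulrBr mulf_eq0 -normr_eq0 z1 oner_eq0 /=.
by rewrite subr_eq0 eq_sym => /eqP.
Qed.
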